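(* Let $m\ge 1$ be a natural number and set $A=\{1,2,\ldots,m\}$. Then the set of continuous positionally determined payoffs from $A^\omega$ to $\mathbb{R}$ coincides with the set of $\varphi\colon A^\omega\to\mathbb{R}$ that can be obtained in the following 5 steps. Step 1. Take a non-empty compact set $K\subseteq\mathbb{R}$. Step 2. Take a continuous metric $d\colon K\times K\to[0,+\infty)$. Step 3. Take $m$ continuous non-decreasing $d$-contracting functions $f_1,f_2,\ldots,f_m\colon K\to K$. Step 4. Consider the payoff $\psi=\psi[f_1,\ldots,f_m]\colon A^\omega\to K$ induced by $f_1,\ldots,f_m$. Step 5. Choose a continuous non-decreasing function $g\colon\psi(A^\omega)\to\mathbb{R}$ and set $\varphi=g\circ\psi$.
   Context: A metric $d\colon K\times K\to[0,+\infty)$ is continuous if it is continuous with respect to the standard (Euclidean) topology on $K\times K\subseteq\mathbb{R}^2$; continuity of functions on subsets of $\mathbb{R}$ is with respect to the standard topology. A function $h\colon K\to K$ is $d$-contracting if $d(h(x),h(y))<d(x,y)$ for all $x,y\in K$ with $x\neq y$. Non-decreasing means $x\le y\implies f(x)\le f(y)$. Induced payoff. If $f_1,\ldots,f_m\colon K\to K$ are continuous and all $d$-contracting for some continuous metric $d$ on $K$, then for every $a_1a_2a_3\ldots\in\{1,\ldots,m\}^\omega$ the set $\bigcap_{n=1}^\infty f_{a_1}\circ f_{a_2}\circ\ldots\circ f_{a_n}(K)$ consists of exactly one point, and the induced payoff $\psi[f_1,\ldots,f_m]\colon\{1,\ldots,m\}^\omega\to K$ maps $a_1a_2a_3\ldots$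 to this point. Payoffs and games. $A^\omega$ denotes the set of infinite words over $A$. A payoff is a bounded function $\varphi\colon A^\omega\to\mathbb{R}$. Continuity of payoffs is with respect to the product topology on $A^\omega$ of the discrete topology on $A$. An $A$-labeled game graph is a tuple $G=\langle V,V_{\mathrm{Max}},V_{\mathrm{Min}},E\rangle$ of finite sets such that $V$ is the disjoint union of $V_{\mathrm{Max}}$ and $V_{\mathrm{Min}}$, $E\subseteq V\times A\times V$, and for every $s\in V$ there exist $a\in A$, $t\in V$ with $(s,a,t)\in E$. For $e=(s,a,t)\in E$ put $\mathsf{source}(e)=s$, $\mathsf{lab}(e)=a$, $\mathsf{target}(e)=t$. A path is a non-empty finite or infinite sequence of edges in which the target of each edge is the source of the next one; moreover, for each $s\in V$ there is a $0$-length path $\lambda_s$ with $\mathsf{source}(\lambda_s)=\mathsf{target}(\lambda_s)=s$. The source of a path of positive length is the source of its first edge, and the target of a finite path of positive length is the target of its last edge. For a path $p$, $\mathsf{lab}(p)$ is the word of labels of its edges, in order. A strategy of Max is a mapping $\sigma$ assigning to every finite path $p$ (including $0$-length paths) with $\mathsf{target}(p)\in V_{\mathrm{Max}}$ an edge whose source is $\mathsf{target}(p)$; strategies of Min are defined analogously with $V_{\mathrm{Min}}$. An infinite path $\mathcal{P}$ is consistent with a strategy of Max $\sigma$ if for every finite prefix $p$ of $\mathcal{P}$ (including the $0$-length one) with $\mathsf{target}(p)\in V_{\mathrm{Max}}$, $\sigma(p)$ is the next edge of $\mathcal{P}$ after $p$; similarly for Min. $\mathsf{Cons}(s,\sigma)$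 is the set of infinite paths starting at $s$ and consistent with $\sigma$. A strategy is positional if its value on a path $p$ depends only on $\mathsf{target}(p)$. The value at $s\in V$ of a strategy of Max $\sigma$ is $\mathbf{Val}[\sigma](s)=\inf\{\varphi(\mathsf{lab}(\mathcal P)) : \mathcal P\in\mathsf{Cons}(s,\sigma)\}$, and of a strategy of Min $\tau$ is $\mathbf{Val}[\tau](s)=\sup\{\varphi(\mathsf{lab}(\mathcal P)) : \mathcal P\in\mathsf{Cons}(s,\tau)\}$. A pair $(\sigma,\tau)$ is an equilibrium (w.r.t. $\varphi$) if $\mathbf{Val}[\sigma](s)=\mathbf{Val}[\tau](s)$ for every $s\in V$. The payoff $\varphi$ is positionally determined if every $A$-labeled game graph has an equilibrium (w.r.t. $\varphi$) consisting of two positional strategies. *)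

(* Defs.v *)
From mathcomp Require Import all_boot all_order all_algebra.
From mathcomp Require Import all_classical all_reals all_analysis.

Set Implicit Arguments.
Unset Strict Implicit.
Unset Printing Implicit Defensive.

Import Order.TTheory GRing.Theory Num.Theory.
Import numFieldNormedType.Exports.

Local Open Scope classical_set_scope.
Local Open Scope ring_scope.

(* Infinite words over A, indexed from 0; as a topological space, the countable
   product of copies of the discrete space A. *)
Notation word A := {ptws nat -> discrete_topology A}.

Record game_graph (A : finType) := GameGraph {
  vertex : finType;
  VMax : {set vertex};
  VMin : {set vertex};
  edges : {set vertex * A * vertex};
  VMaxMin_cover : (VMax :|: VMin = [set: vertex])%SET;
  VMaxMin_disjoint : [disjoint VMax & VMin]%B;
  has_move : forall s, exists a t, (s, a, t) \in edges
}.

Section Paths.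
Variables (A : finType) (G : game_graph A).

Definition edge : Type := vertex G * A * vertex G.
Definition source (e : edge) : vertex G := e.1.1.
Definition lab (e : edge) : A := e.1.2.
Definition target (e : edge) : vertex G := e.2.

Fixpoint is_fpath (s : vertex G) (p : seq edge) : bool :=
  if p is e :: p' then
    [&& e \in edges G, source e == s & is_fpath (target e) p']
  else true.

(* Recording the source makes FPath s [::] the 0-length path at s; for a
   nonempty sequence of edges, the source is forced. *)
Record fpath := FPath {
  fsource : vertex G;
  fedges : seq edge;
  fpathP : is_fpath fsource fedges
}.

Definition ftarget (p : fpath) : vertex G :=
  last (fsource p) (map target (fedges p)).

Record ipath := IPath {
  iedge :> nat -> edge;
  iedge_in : forall n, iedge n \in edges G;
  iedge_next : forall n, target (iedge n) = source (iedge n.+1)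
}.

Definition isource (P : ipath) : vertex G := source (P 0%N).
Definition ilab (P : ipath) : word A := fun n => lab (P n).

Lemma is_fpath_prefix (P : ipath) n : is_fpath (isource P) (mkseq P n).
Proof.
rewrite /isource /mkseq; elim: n 0%N => //= n IHn k.
by rewrite iedge_in eqxx iedge_next IHn.
Qed.

Definition iprefix (P : ipath) (n : nat) : fpath :=
  FPath (is_fpath_prefix P n).

(* Strategies of the player controlling the vertices in U. *)
Record strategy (U : {set vertex G}) := Strategy {
  move : forall p : fpath, ftarget p \in U -> edge;
  move_in : forall p (Up : ftarget p \in U), move Up \in edges G;
  move_source : forall p (Up : ftarget p \in U), source (move Up) = ftarget p
}.

Definition consistent U (sigma : strategy U) (P : ipath) : Prop :=
  forall n (Un : ftarget (iprefix P n) \in U), move sigma Un = P n.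

Definition Cons U (s : vertex G) (sigma : strategy U) : set ipath :=
  [set P | isource P = s /\ consistent sigma P].

Definition positional U (sigma : strategy U) : Prop :=
  forall p q (Up : ftarget p \in U) (Uq : ftarget q \in U),
    ftarget p = ftarget q -> move sigma Up = move sigma Uq.

End Paths.

Section Payoffs.
Variables (R : realType) (A : finType).
Implicit Types (phi : word A -> R) (G : game_graph A).

Definition is_payoff phi : Prop := exists M, forall w, `|phi w| <= M.

(* Real-valued inf and sup: Cons s sigma is never empty, and these values are
   only used for bounded phi. *)
Definition ValMax phi G (sigma : strategy (VMax G)) (s : vertex G) : R :=
  inf [set phi (ilab P) | P in Cons s sigma].

Definition ValMin phi G (tau : strategy (VMin G)) (s : vertex G) : R :=
  sup [set phi (ilab P) | P in Cons s tau].

Definition equilibrium phi G (sigma : strategy (VMax G))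
    (tau : strategy (VMin G)) : Prop :=
  forall s, ValMax phi sigma s = ValMin phi tau s.

Definition positionally_determined phi : Prop :=
  forall G, exists (sigma : strategy (VMax G)) (tau : strategy (VMin G)),
    [/\ positional sigma, positional tau & equilibrium phi sigma tau].

End Payoffs.

(* Functions on a subset K of R are represented by total functions on R of which
   only the restriction to K is constrained and used. *)
Section InducedPayoff.
Variables (R : realType) (A : finType).
Implicit Types (K : set R) (d : R -> R -> R) (h g : R -> R) (f : A -> R -> R).

Definition metric_on K d : Prop :=
  [/\ forall x y, K x -> K y -> 0 <= d x y,
      forall x y, K x -> K y -> (d x y = 0 <-> x = y),
      forall x y, K x -> K y -> d x y = d y x &
      forall x y z, K x -> K y -> K z -> d x z <= d x y + d y z].

Definition continuous_metric_on K d : Prop :=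
  metric_on K d /\ {within K `*` K, continuous (fun p : R * R => d p.1 p.2)}.

Definition contracting_on K d h : Prop :=
  forall x y, K x -> K y -> x <> y -> d (h x) (h y) < d x y.

Definition nondecreasing_on K g : Prop :=
  forall x y, K x -> K y -> x <= y -> g x <= g y.

(* comp_word f w n = f (w 0) \o f (w 1) \o ... \o f (w n.-1) *)
Fixpoint comp_word f (w : word A) (n : nat) : R -> R :=
  if n is n'.+1 then comp_word f w n' \o f (w n') else id.

(* The point of the intersection; it is unique when K is nonempty and compact
   and the f a are continuous self-maps of K, all contracting for one continuous
   metric, so that the default value 0 is then irrelevant. *)
Definition induced_payoff K f (w : word A) : R :=
  xget 0 (\bigcap_n (comp_word f w n.+1 @` K)).

Definition obtainable (phi : word A -> R) : Prop :=
  exists (K : set R) (d : R -> R -> R) (f : A -> R -> R) (g : R -> R),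
    [/\ K !=set0 /\ compact K,
        continuous_metric_on K d,
        forall a, [/\ forall x, K x -> K (f a x),
                      {within K, continuous (f a)},
                      nondecreasing_on K (f a) &
                      contracting_on K d (f a)],
        {within range (induced_payoff K f), continuous g} /\
        nondecreasing_on (range (induced_payoff K f)) g &
        phi = g \o induced_payoff K f].

End InducedPayoff.

(* Main.v *)
Require Import Defs.
From mathcomp Require Import all_boot all_order all_algebra.
From mathcomp Require Import all_classical all_reals all_analysis.
From mathcomp Require Import lra.
Import numFieldNormedType.Exports.
Local Open Scope classical_set_scope.

Set Implicit Arguments.
Unset Strict Implicit.
Unset Printing Implicit Defensive.
Import Order.TTheory GRing.Theory Num.Theory.
Local Open Scope ring_scope.

(* From the construction to determinacy: by compactness the images of K under
   the compositions of the f_a shrink uniformly, which makes psi continuous. On a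
   game graph the Bellman operator (max or min over the outgoing edges of
   f_a (v t)) is monotone on vectors with values in K, so it has a fixpoint v by
   Knaster-Tarski; this only uses the order on K, since d need not interact well
   with max and min. Following the edges that realize the max or min is a
   positional strategy, and v propagates along plays through the nondecreasing
   f_a, which bounds psi of the play by v from the appropriate side.

   From determinacy to the construction: in a one-player graph in which two
   prefixes u, v lead to a common vertex where one of two continuations is chosen,
   a positional strategy is optimal after both prefixes. Hence the words are
   totally preordered by w <= w' iff phi (u w) <= phi (u w') for all finite u. The
   weighted sum psi w of all phi (u w) embeds this preorder in the reals, and
   f_a (psi w) = psi (a w), g (psi w) = phi w are well defined. With the metric
   sup_u (2 - 2^-|u|) |phi (u w) - phi (u w')| each f_a is contracting, because
   prepending a lengthens the prefixes and the weights increase strictly. *)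

(** * Uniform continuity on the space of words *)

Section Words.
Variables (R : realType) (A : finType).

Definition agree (n : nat) (w w' : word A) := forall i, (i < n)%N -> w i = w' i.

Lemma agree_le n k w w' : (n <= k)%N -> agree k w w' -> agree n w w'.
Proof. by move=> nk ww' i ilt; apply: ww'; apply: leq_trans nk. Qed.

Lemma agree_trans n w1 w2 w3 : agree n w1 w2 -> agree n w2 w3 -> agree n w1 w3.
Proof. by move=> h k i ilt; rewrite h// k. Qed.

Lemma cylinder_nbhs (w : word A) n : nbhs w (agree n w).
Proof.
elim: n => [|n IHn]; first by apply: filterS filterT => w' _ i.
have pn : nbhs w [set w' : word A | w n = w' n].
  have /(_ [set w n]) := @proj_continuous _ (fun=> discrete_topology A) n w.
  move=> /(_ (@discrete_set1 (discrete_topology A) _)) pn.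
  by apply: (@filterS _ (nbhs w) _ _ _ _ pn) => w' /esym.
apply: filterS2 pn IHn => w' /= en e i; rewrite ltnS leq_eqVlt => /predU1P[->//|].
exact: e.
Qed.

(** If every cylinder around [w] left [U], picking a word outside [U] from each one would give a
    sequence converging to [w]. *)
Lemma nbhs_cylinder (w : word A) U :
  nbhs w U -> exists n, agree n w `<=` U.
Proof.
move=> wU; apply: contrapT => noN.
have /choice[v vP] : forall n, exists w', agree n w w' /\ ~ U w'.
  move=> n; apply: contrapT => noW; apply: noN; exists n => w' aw.
  by apply: contrapT => nUw; apply: noW; exists w'.
have vw : v n @[n --> \oo] --> w.
  (* Convergence in the product is checked on each coordinate [i], where the sequence is constant
     from index [i.+1] on. *)
  apply/cvg_sup => i; apply/cvg_image.
    by rewrite eqEsubset; split => // a _; exists (fun=> a).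
  move=> B Bi; exists (@proj nat (fun=> discrete_topology A) i @^-1` B).
    exists i.+1 => // n /= ltin; rewrite /proj -(vP n).1//.
    exact: nbhs_singleton Bi.
  by rewrite image_preimage// eqEsubset; split => // a _; exists (fun=> a).
have [n _ nP] := vw _ wU.
by have [_] := vP n; apply; apply: (nP n) => /=.
Qed.

Lemma compact_word : compact [set: word A].
Proof.
have finA : finite_set [set: discrete_topology A] := @finite_finset A setT.
have := @tychonoff nat (fun=> discrete_topology A) _ (fun=> finite_compact finA).
by congr (compact _); rewrite eqEsubset.
Qed.

Lemma word_continuousP (phi : word A -> R) : continuous phi <->
  forall w e, 0 < e -> exists n, forall w', agree n w w' -> `|phi w - phi w'| < e.
Proof.
split=> [phic w e e0|phiP w].
  have /cvgrPdist_lt/(_ e e0)/nbhs_cylinder[n nP] := phic w.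
  by exists n => w' /nP.
apply/(@cvgrPdist_lt R R^o (word A) (nbhs w)) => e e0; have [n nP] := phiP w e e0.
exact: (@filterS _ (nbhs w) _ _ _ (nP : agree n w `<=` _) (cylinder_nbhs w n)).
Qed.

Lemma word_unif_continuous (phi : word A -> R) : continuous phi ->
  forall e, 0 < e -> exists n, forall w w', agree n w w' -> `|phi w - phi w'| < e.
Proof.
move=> /word_continuousP phic e e0; have e20 : 0 < e / 2 by rewrite divr_gt0.
have /compact_near_coveringP cov := compact_word.
(* The near-covering form of compactness, along the filter [\oo] of lengths, turns a length valid
   near each word into one valid for all words. *)
have [|n _ nP] := cov nat \oo (fun n w => forall w', agree n w w' -> `|phi w - phi w'| < e) _.
  move=> w _; have [n nP] := phic w _ e20.
  exists (agree n w, [set k | (n <= k)%N]).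
    by split; [exact: cylinder_nbhs|exists n].
  move=> [w1 k] [/= h1 nk] w2 h2.
  have := nP _ h1; have := nP _ (agree_trans h1 (agree_le nk h2)).
  move=> l2 l1; have := ler_distD (phi w) (phi w1) (phi w2).
  by rewrite (distrC (phi w1) (phi w)); lra.
by exists n => w w'; apply: (nP n) => //=.
Qed.

End Words.

(** * Continuity and compactness relative to a subset *)

Section WithinContinuity.

Lemma within_continuous_into (T U V : topologicalType) (S : set T) (S' : set U)
    (h : T -> U) (k : U -> V) :
  {within S, continuous h} -> {within S', continuous k} ->
  (forall x, S x -> S' (h x)) -> {within S, continuous (k \o h)}.
Proof.
move=> /subspace_continuousP hc /subspace_continuousP kc hS.
apply/subspace_continuousP => x Sx B /= kB.
have := kc _ (hS x Sx) _ kB; rewrite nbhs_filterE /= => /(hc x Sx) /=.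
rewrite /within /= !nbhs_filterE /=; apply: filterS => y Q Sy; exact: Q (hS _ Sy).
Qed.

Lemma within_continuous_pair (T U V : topologicalType) (S : set T)
    (h : T -> U) (k : T -> V) :
  {within S, continuous h} -> {within S, continuous k} ->
  {within S, continuous (fun x => (h x, k x))}.
Proof. by move=> hc kc x; apply: cvg_pair; [exact: hc|exact: kc]. Qed.

Lemma continuous_square (T U : topologicalType) (h : T -> U) :
  continuous h -> continuous (fun p : T * T => (h p.1, h p.2)).
Proof.
move=> hc p; apply: cvg_pair.
  by apply: (cvg_comp _ _ cvg_fst); exact: hc.
by apply: (cvg_comp _ _ cvg_snd); exact: hc.
Qed.

(** A continuous map from a compact space to a Hausdorff space is closed, hence a quotient map onto
    its range. This later carries continuity from words over to reals. *)
Lemma continuous_factor (T Y Z : topologicalType) (psi : T -> Y) (h : Y -> Z) :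
  compact [set: T] -> hausdorff_space Y -> continuous psi ->
  continuous (h \o psi) -> {within range psi, continuous h}.
Proof.
move=> Tc Yh psic hc; apply/continuous_closedP => B Bcl; apply/closed_subspaceP.
exists (psi @` ((h \o psi) @^-1` B)).
  apply: compact_closed => //; apply: continuous_compact.
    exact: continuous_subspaceT.
  rewrite -[X in compact X]setTI; apply: compact_closedI => //.
  by move/continuous_closedP: hc; apply.
rewrite eqEsubset; split => [y [[x /= hx <-] xr]//|y [/= By [x _ xy]]].
by split; exists x => //=; rewrite xy.
Qed.

Variable (R : realType).

Lemma compact_superlevel (T : topologicalType) (S : set T) (h : T -> R) e :
  compact S -> {within S, continuous h} -> compact (S `&` [set x | e <= h x]).
Proof.
move=> Sc /continuous_closedP /(_ _ (@closed_ge R e)) /closed_subspaceP[V Vcl VS].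
have -> : S `&` [set x | e <= h x] = S `&` V by rewrite ![S `&` _]setIC VS.
exact: compact_closedI.
Qed.

Lemma compact_lower_bound (T : topologicalType) (S : set T) (h : T -> R) :
  compact S -> {within S, continuous h} -> (forall x, S x -> 0 < h x) ->
  exists2 c, 0 < c & forall x, S x -> c <= h x.
Proof.
move=> Sc hc h0; have [->|/set0P[x Sx]] := eqVneq S set0.
  by exists 1.
have [c cS cP] := compact_EVT_min (ex_intro _ x Sx) Sc hc.
by exists (h c); [exact/h0/set_mem|move=> y Sy; apply/cP/mem_set].
Qed.

Lemma compact_upper_bound (T : topologicalType) (S : set T) (h : T -> R) :
  compact S -> {within S, continuous h} ->
  exists c, forall x, S x -> h x <= c.
Proof.
move=> Sc hc; have [->|/set0P[x Sx]] := eqVneq S set0.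
  by exists 1.
have [c cS cP] := compact_EVT_max (ex_intro _ x Sx) Sc hc.
by exists (h c); move=> y Sy; apply/cP/mem_set.
Qed.

(** Completeness of compact sets of reals under suprema, which is what the Knaster-Tarski argument
    requires. *)
Lemma compact_sup_mem (K B : set R) :
  compact K -> B !=set0 -> B `<=` K -> K (sup B) /\ has_sup B.
Proof.
move=> Kc B0 BK.
have Kcl : closed K by apply: compact_closed => //; exact: Rhausdorff.
have idc : {within K, continuous (@id R)} by apply: continuous_subspaceT => x.
have [M MP] := compact_upper_bound Kc idc.
have Bub : has_ubound B by exists M => x /BK /MP.
by split => //; apply/Kcl/(closureS BK)/closure_sup.
Qed.

End WithinContinuity.

(** * Payoffs induced by contracting maps *)

Section ShiftedWords.
Variables (R : realType) (A : finType) (f : A -> R -> R).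

Definition shift (n : nat) (w : word A) : word A := fun i => w (n + i)%N.

Lemma comp_word_agree n w w' : agree n w w' -> comp_word f w n = comp_word f w' n.
Proof.
elim: n => //= n IHn ww'; rewrite ww'// IHn//; exact: agree_le ww'.
Qed.

Lemma comp_word_add n k w x :
  comp_word f w (n + k) x = comp_word f w n (comp_word f (shift n w) k x).
Proof. by elim: k x => [|k IHk] x; [rewrite addn0|rewrite addnS /= IHk]. Qed.

End ShiftedWords.

Section ContractingMaps.
Variables (R : realType) (A : finType) (K : set R) (d : R -> R -> R).
Variable f : A -> R -> R.
Hypotheses (K0 : K !=set0) (Kc : compact K) (dm : continuous_metric_on K d).
Hypothesis fK : forall a x, K x -> K (f a x).
Hypothesis fcont : forall a, {within K, continuous (f a)}.
Hypothesis fnd : forall a, nondecreasing_on K (f a).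
Hypothesis fcontr : forall a, contracting_on K d (f a).

Lemma comp_word_in w n x : K x -> K (comp_word f w n x).
Proof. by elim: n x => //= n IHn x Kx; apply/IHn/fK. Qed.

Lemma comp_word_nondecreasing w n : nondecreasing_on K (comp_word f w n).
Proof.
by elim: n => //= n IHn x y Kx Ky xy; apply: IHn; [exact: fK..|exact: fnd].
Qed.

Lemma comp_word_continuous w n : {within K, continuous (comp_word f w n)}.
Proof.
elim: n => [|n IHn] /=; first by apply: continuous_subspaceT => x.
exact: within_continuous_into (@fcont _) IHn (@fK _).
Qed.

Lemma dist_contracting_le a x y : K x -> K y -> d (f a x) (f a y) <= d x y.
Proof.
move=> Kx Ky; have [->|/eqP xy] := eqVneq x y; last by rewrite ltW// fcontr.
have [[_ d0 _ _] _] := dm.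
by rewrite ((d0 (f a y) (f a y) (fK _ Ky) (fK _ Ky)).2 erefl) ((d0 y y Ky Ky).2 erefl).
Qed.

Lemma dist_comp_word_le w n x y :
  K x -> K y -> d (comp_word f w n x) (comp_word f w n y) <= d x y.
Proof.
elim: n x y => //= n IHn x y Kx Ky.
by rewrite (le_trans (IHn _ _ (fK _ Kx) (fK _ Ky)))// dist_contracting_le.
Qed.

(** On the compact set of pairs at distance at least [e], the decrease of [d] under [f a] is
    continuous and positive, so it has a positive minimum. *)
Lemma contraction_gap e : 0 < e ->
  exists2 c, 0 < c & forall a x y, K x -> K y -> e <= d x y ->
    d (f a x) (f a y) <= d x y - c.
Proof.
move=> e0; have [[_ d0 _ _] dc] := dm.
have Cc := compact_superlevel (e := e) (compact_setX Kc Kc) dc.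
have gap a : exists2 c, 0 < c & forall x y, K x -> K y -> e <= d x y ->
    d (f a x) (f a y) <= d x y - c.
  have hc : {within (K `*` K) `&` [set p | e <= d p.1 p.2],
      continuous (fun p : R * R => d p.1 p.2 - d (f a p.1) (f a p.2))}.
    apply: (@continuous_subspaceW _ _ _ (K `*` K)); first exact: subIsetl.
    have fac : {within K `*` K, continuous (fun p => (f a p.1, f a p.2))}.
      apply: within_continuous_pair.
        apply: (@within_continuous_into _ _ _ _ K fst (f a)) => //; last by move=> p [].
        by apply: continuous_subspaceT => p; exact: cvg_fst.
      apply: (@within_continuous_into _ _ _ _ K snd (f a)) => //; last by move=> p [].
      by apply: continuous_subspaceT => p; exact: cvg_snd.
    have dfc := within_continuous_into fac dc.
    move=> p; apply: cvgB; first exact: dc.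
    by apply: dfc => q [/= K1 K2]; split; exact: fK.
  have [|c c0 cP] := compact_lower_bound Cc hc.
    move=> [x y] [[/= Kx Ky] exy]; rewrite subr_gt0 fcontr// => xy.
    by move: exy; rewrite ((d0 x y Kx Ky).2 xy) leNgt e0.
  exists c => // x y Kx Ky exy; have := cP (x, y) (conj (conj Kx Ky) exy).
  by rewrite /=; lra.
pose c a := sval (cid2 (gap a)).
(* A minimum over finitely many letters; the initial value [1] keeps it positive even over an empty
   alphabet. *)
exists (\big[Num.min/1]_a c a).
  by apply: lt_bigmin => // a _; rewrite /c; case: cid2.
move=> a x y Kx Ky exy; have le_c : \big[Num.min/1]_a c a <= c a by exact: bigmin_le.
have : d (f a x) (f a y) <= d x y - c a by rewrite /c; case: cid2 => /= *; auto.
by lra.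
Qed.

(** While the distance is at least [e], each letter lowers it by at least [c]; once below [e] it
    stays there. With [D] bounding [d] on [K], more than [D / c] letters suffice. *)
Lemma comp_word_dist_shrink e : 0 < e ->
  exists n, forall w x y, K x -> K y -> d (comp_word f w n x) (comp_word f w n y) < e.
Proof.
move=> e0; have [c c0 gap] := contraction_gap e0.
have [[dge0 _ _ _] dc] := dm.
have [D DP] := compact_upper_bound (compact_setX Kc Kc) dc.
have step n w x y : K x -> K y ->
    d (comp_word f w n x) (comp_word f w n y) < e \/
    d (comp_word f w n x) (comp_word f w n y) <= d x y - c *+ n.
  elim: n x y => [|n IHn] x y Kx Ky; first by right; rewrite subr0.
  have [exy|dxy] := leP e (d x y); last first.
    by left; exact: le_lt_trans (dist_comp_word_le _ _ _ _) dxy.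
  have [?|le_n] := IHn _ _ (fK (w n) Kx) (fK (w n) Ky); [by left|right].
  by rewrite (le_trans le_n)// mulrS; have := gap (w n) _ _ Kx Ky exy; lra.
have D0 : 0 <= D by have [x Kx] := K0; exact: le_trans (dge0 x x Kx Kx) (DP (x, x) _).
have := archi_boundP (divr_ge0 D0 (ltW c0)).
set n := Num.bound _; rewrite ltr_pdivrMr// => Dn.
exists n => w x y Kx Ky; have [//|] := step n w x y Kx Ky.
have := dge0 _ _ (comp_word_in w n Kx) (comp_word_in w n Ky).
have := DP (x, y) (conj Kx Ky); move: Dn; rewrite mulr_natl /=; lra.
Qed.

(** Passes from [d] to the Euclidean distance: [d] has a positive lower bound on the compact set of
    pairs with [e <= |x - y|]. *)
Lemma comp_word_shrink e : 0 < e ->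
  exists n, forall w x y, K x -> K y -> `|comp_word f w n x - comp_word f w n y| < e.
Proof.
move=> e0; have [[dge0 d0 _ _] dc] := dm.
have nc : {within K `*` K, continuous (fun p : R * R => `|p.1 - p.2|)}.
  apply: continuous_subspaceT => p; apply: cvg_norm.
  by apply: cvgB; [exact: cvg_fst|exact: cvg_snd].
have Cc := compact_superlevel (e := e) (compact_setX Kc Kc) nc.
have [||c c0 cP] := compact_lower_bound Cc (h := fun p => d p.1 p.2).
- by apply: continuous_subspaceW dc; exact: subIsetl.
- move=> [x y] [[/= Kx Ky] exy]; rewrite lt_neqAle dge0// andbT eq_sym.
  by apply/eqP => /(d0 x y Kx Ky) xy; move: exy; rewrite xy subrr normr0 leNgt e0.
have [n nP] := comp_word_dist_shrink c0; exists n => w x y Kx Ky.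
rewrite ltNge; apply/negP => exy.
have := cP (_, _) (conj (conj (comp_word_in w n Kx) (comp_word_in w n Ky)) exy).
by rewrite /= leNgt nP.
Qed.

Let psi := induced_payoff K f.

Lemma induced_payoff_in_image w n : (comp_word f w n @` K) (psi w).
Proof.
suff [p pP] : (\bigcap_n (comp_word f w n.+1 @` K)) !=set0.
  have /(_ n I)[x Kx <-] : (\bigcap_n (comp_word f w n.+1 @` K)) (psi w).
    exact: xgetI pP.
  (* The intersection starts at words of length 1; image [n] is reached because it contains image
     [n.+1]. *)
  by exists (f (w n) x) => //; exact: fK.
have [x0 Kx0] := K0.
(* A cluster point of the orbit of [x0] lies in every image, since each image is closed and contains
   a tail of the orbit. *)
have [p [Kp pP]] := Kc (fmap_proper_filter (comp_word f w ^~ x0) _)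
  (nearW _ (fun n => comp_word_in w n Kx0) : \forall n \near \oo, _).
exists p => k _.
have imcl : closed (comp_word f w k.+1 @` K).
  apply: compact_closed; first exact: Rhausdorff.
  by apply: continuous_compact Kc; exact: comp_word_continuous.
apply: imcl => B pB; apply: pP => //.
exists k.+1 => // j /= kj; rewrite -(subnKC kj) comp_word_add.
by exists (comp_word f (shift k.+1 w) (j - k.+1) x0) => //; exact: comp_word_in.
Qed.

Lemma induced_payoff_approx e : 0 < e -> exists n, forall w x, K x ->
  `|psi w - comp_word f w n x| < e.
Proof.
move=> /comp_word_shrink[n nP]; exists n => w x Kx.
by have [y Ky <-] := induced_payoff_in_image w n; exact: nP.
Qed.

Lemma induced_payoff_continuous : continuous psi.
Proof.
apply/word_continuousP => w e e0.
have [n nP] := comp_word_shrink e0; exists n => w' ww'.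
have [x Kx <-] := induced_payoff_in_image w n.
have [y Ky <-] := induced_payoff_in_image w' n.
by rewrite -(comp_word_agree f ww'); exact: nP.
Qed.

(** The point [x n] may change with [n] because the approximation of [psi w] is uniform over [K].
    Along a play, [x n] will be the potential of the [n]-th vertex. *)
Lemma induced_payoff_lower w (x : nat -> R) b : (forall n, K (x n)) ->
  (forall n, b <= comp_word f w n (x n)) -> b <= psi w.
Proof.
move=> Kx bx; apply/ler_addgt0Pr => e e0.
have [n /(_ w _ (Kx n))] := induced_payoff_approx e0.
by have := bx n; rewrite ltr_norml => ? /andP[]; lra.
Qed.

Lemma induced_payoff_upper w (x : nat -> R) b : (forall n, K (x n)) ->
  (forall n, comp_word f w n (x n) <= b) -> psi w <= b.
Proof.
move=> Kx bx; apply/ler_addgt0Pr => e e0.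
have [n /(_ w _ (Kx n))] := induced_payoff_approx e0.
by have := bx n; rewrite ltr_norml => ? /andP[]; lra.
Qed.

End ContractingMaps.

(** * Positional strategies for induced payoffs *)

Section Plays.
Variables (A : finType) (G : game_graph A).

Lemma ftarget_iprefix (P : ipath G) n : ftarget (iprefix P n) = source (P n).
Proof.
case: n => [//|n].
rewrite -[LHS]/(last (isource P) (map (@target A G) (mkseq P n.+1))).
by rewrite mkseqS map_rcons last_rcons iedge_next.
Qed.

Variables (mv : vertex G -> edge G) (mvE : forall s, mv s \in edges G).
Hypothesis mv_source : forall s, source (mv s) = s.

Definition positional_strategy (U : {set vertex G}) : strategy U :=
  @Strategy A G U (fun p _ => mv (ftarget p)) (fun p _ => mvE (ftarget p))
    (fun p _ => mv_source (ftarget p)).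

Lemma positional_strategyP U : positional (positional_strategy U).
Proof. by move=> p q Up Uq /= ->. Qed.

Lemma consistent_positional_strategy U (P : ipath G) :
  consistent (positional_strategy U) P <->
  forall n, source (P n) \in U -> P n = mv (source (P n)).
Proof.
split=> [cP n Un|hP n Un /=].
  by have := cP n; rewrite /= ftarget_iprefix => /(_ Un).
by rewrite ftarget_iprefix -hP// -ftarget_iprefix.
Qed.

Definition play_edge s n := mv (iter n (fun t => target (mv t)) s).

Lemma play_edge_next s n : target (play_edge s n) = source (play_edge s n.+1).
Proof. by rewrite /play_edge mv_source. Qed.

Definition play s : ipath G := IPath (fun n => mvE _) (play_edge_next s).

Lemma isource_play s : isource (play s) = s.
Proof. exact: mv_source. Qed.

Lemma consistent_play U s : consistent (positional_strategy U) (play s).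
Proof. by apply/consistent_positional_strategy => n _ /=; rewrite mv_source. Qed.

End Plays.

(** The fixpoint is the pointwise supremum of all [x] with [x <= T x], a family containing the
    constant vector at the minimum of [K]. *)
Lemma knaster_tarski (R : realType) (V : Type) (K : set R) (T : (V -> R) -> V -> R) :
  K !=set0 -> compact K ->
  (forall x, (forall s, K (x s)) -> forall s, K (T x s)) ->
  (forall x y, (forall s, K (x s)) -> (forall s, K (y s)) ->
    (forall s, x s <= y s) -> forall s, T x s <= T y s) ->
  exists2 v, forall s, K (v s) & T v = v.
Proof.
move=> K0 Kc TK Tmono.
pose pre x := (forall s, K (x s)) /\ forall s, x s <= T x s.
pose B s := [set x s | x in pre].
have Kinf : exists2 b, K b & forall x, K x -> b <= x.
  have idc : {within K, continuous (@id R)} by apply: continuous_subspaceT => x.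
  have [b /set_mem Kb bP] := compact_EVT_min K0 Kc idc.
  by exists b => // x Kx; apply/bP/mem_set.
have [b Kb bP] := Kinf.
have preb : pre (fun=> b) by split => // s; exact/bP/TK.
have BK s : B s `<=` K by move=> _ [x [Kx _] <-].
have Bsup s : K (sup (B s)) /\ has_sup (B s).
  by apply: compact_sup_mem => //; exists b; exists (fun=> b).
pose v s := sup (B s).
have Kv s : K (v s) := (Bsup s).1.
have vub x s : pre x -> x s <= v s.
  by move=> px; apply: (ub_le_sup (Bsup s).2.2); exists x.
have vT s : v s <= T v s.
  apply: ge_sup; first by exists b, (fun=> b).
  move=> _ [x px <-]; rewrite (le_trans (px.2 s))// Tmono//; first exact: px.1.
  by move=> s'; exact: vub.
exists v => //; apply/funext => s; apply/eqP; rewrite eq_le vT andbT.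
by apply: (vub (T v)); split; [exact: TK|move=> s'; apply: Tmono => //; exact: TK].
Qed.

Section OptimalMoves.
Variables (R : realType) (A : finType) (K : set R) (f : A -> R -> R).
Hypotheses (K0 : K !=set0) (Kc : compact K).
Hypothesis fK : forall a x, K x -> K (f a x).
Hypothesis fnd : forall a, nondecreasing_on K (f a).
Variable G : game_graph A.

Definition edge_value (x : vertex G -> R) (e : edge G) : R :=
  f (lab e) (x (target e)).

Lemma some_move s : exists e : edge G, (e \in edges G) && (source e == s).
Proof. by have [a [t e]] := has_move s; exists (s, a, t); rewrite e eqxx. Qed.

(** A single rule serves both players, so the play that follows it is consistent with both resulting
    strategies. *)
Definition optimal_move (x : vertex G -> R) (s : vertex G) : edge G :=
  if s \in VMax G then
    [arg max_(e > xchoose (some_move s) | (e \in edges G) && (source e == s))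
       edge_value x e]%O
  else
    [arg min_(e < xchoose (some_move s) | (e \in edges G) && (source e == s))
       edge_value x e]%O.

Lemma optimal_moveP x s :
  [/\ optimal_move x s \in edges G, source (optimal_move x s) = s &
   forall e, e \in edges G -> source e = s ->
     if s \in VMax G then edge_value x e <= edge_value x (optimal_move x s)
     else edge_value x (optimal_move x s) <= edge_value x e].
Proof.
rewrite /optimal_move; case: ifP => _.
  case: arg_maxP => [|e /andP[eE /eqP es] eP]; first exact: (xchooseP (some_move s)).
  by split => // e' e'E /eqP e's; apply: eP; rewrite e'E.
case: arg_minP => [|e /andP[eE /eqP es] eP]; first exact: (xchooseP (some_move s)).
by split => // e' e'E /eqP e's; apply: eP; rewrite e'E.
Qed.

Lemma bellman_solution : exists2 v : vertex G -> R, forall s, K (v s) &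
  forall s, v s = edge_value v (optimal_move v s).
Proof.
have [||v Kv vE] := @knaster_tarski R (vertex G) K
  (fun x s => edge_value x (optimal_move x s)) K0 Kc.
- by move=> x Kx s; exact: fK.
- move=> x y Kx Ky xy s.
  have mono e : edge_value x e <= edge_value y e by exact: fnd.
  have [xE xs xP] := optimal_moveP x s; have [yE ys yP] := optimal_moveP y s.
  (* The optimal edges for [x] and [y] may differ. At a Max vertex the edge of [x] is compared under
     [y]; at any other vertex the edge of [y] is compared under [x]. *)
  have := yP _ xE xs; have := xP _ yE ys; case: ifP => _ h1 h2.
    exact: le_trans (mono _) h2.
  exact: le_trans h1 (mono _).
by exists v => // s; rewrite -[LHS](congr1 (@^~ s) vE).
Qed.

End OptimalMoves.

(** * Obtainable payoffs are positionally determined *)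

Section ObtainableIsDetermined.
Variables (R : realType) (A : finType) (K : set R) (d : R -> R -> R).
Variables (f : A -> R -> R) (g : R -> R).
Hypotheses (K0 : K !=set0) (Kc : compact K) (dm : continuous_metric_on K d).
Hypothesis fK : forall a x, K x -> K (f a x).
Hypothesis fcont : forall a, {within K, continuous (f a)}.
Hypothesis fnd : forall a, nondecreasing_on K (f a).
Hypothesis fcontr : forall a, contracting_on K d (f a).
Let psi := induced_payoff K f.
Hypothesis gnd : nondecreasing_on (range psi) g.

(** The edge inequalities chain through the nondecreasing maps to [v (isource P) <= comp_word f
    (ilab P) n (v (source (P n)))] for all [n]. *)
Lemma potential_lower (G : game_graph A) (v : vertex G -> R) (P : ipath G) :
  (forall s, K (v s)) ->
  (forall n, v (source (P n)) <= edge_value f v (P n)) ->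
  v (isource P) <= psi (ilab P).
Proof.
move=> Kv vP; apply: (induced_payoff_lower K0 Kc dm fK fcont fcontr
  (x := fun n => v (source (P n)))) => //.
elim=> //= n IHn; apply: le_trans IHn _; rewrite -iedge_next.
by apply: (comp_word_nondecreasing fK fnd); [exact: Kv|exact: fK|exact: vP].
Qed.

Lemma potential_upper (G : game_graph A) (v : vertex G -> R) (P : ipath G) :
  (forall s, K (v s)) ->
  (forall n, edge_value f v (P n) <= v (source (P n))) ->
  psi (ilab P) <= v (isource P).
Proof.
move=> Kv vP; apply: (induced_payoff_upper K0 Kc dm fK fcont fcontr
  (x := fun n => v (source (P n)))) => //.
elim=> //= n IHn; apply: le_trans IHn; rewrite -iedge_next.
by apply: (comp_word_nondecreasing fK fnd); [exact: fK|exact: Kv|exact: vP].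
Qed.

Lemma VMaxPn (G : game_graph A) (s : vertex G) : (s \in VMin G) = (s \notin VMax G).
Proof.
have := VMaxMin_cover G => /setP/(_ s); rewrite !inE.
have := VMaxMin_disjoint G => /pred0P/(_ s) /=.
by case: (s \in VMax G) => //= -> .
Qed.

Lemma induced_positionally_determined : positionally_determined (g \o psi).
Proof.
move=> G; have [v Kv vE] := bellman_solution K0 Kc fK fnd G.
have mvE s : optimal_move f v s \in edges G by case: (optimal_moveP f v s).
have mvs s : source (optimal_move f v s) = s by case: (optimal_moveP f v s).
pose sigma := positional_strategy mvE mvs (VMax G).
pose tau := positional_strategy mvE mvs (VMin G).
exists sigma, tau; split; [exact: positional_strategyP..|] => s.
have lower P : Defs.Cons s sigma P -> v s <= psi (ilab P).
  move=> [<- /consistent_positional_strategy cP]; apply: potential_lower => // n.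
  have [_ _ opt] := optimal_moveP f v (source (P n)).
  have := opt _ (iedge_in P n) erefl; rewrite -vE; case: ifP => // /cP e _.
  by rewrite [leLHS]vE -e.
have upper P : Defs.Cons s tau P -> psi (ilab P) <= v s.
  move=> [<- /consistent_positional_strategy cP]; apply: potential_upper => // n.
  have [_ _ opt] := optimal_moveP f v (source (P n)).
  have := opt _ (iedge_in P n) erefl; rewrite -vE; case: ifP => // /negbT.
  by rewrite -VMaxPn => /cP e _; rewrite [leRHS]vE -e.
(* Lying in both sets of consistent plays, [P0] has [psi] exactly [v s], so [g (v s)] is attained
   both as the infimum and as the supremum. *)
pose P0 := play mvE mvs s.
have P0s : Defs.Cons s sigma P0 by split; [exact: isource_play|exact: consistent_play].
have P0t : Defs.Cons s tau P0 by split; [exact: isource_play|exact: consistent_play].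
have psiP0 : psi (ilab P0) = v s by apply/eqP; rewrite eq_le upper// lower.
transitivity (g (psi (ilab P0))).
  apply/eqP; rewrite eq_le; apply/andP; split.
    apply: ge_inf; last by exists P0.
    exists (g (psi (ilab P0))) => _ [P /lower vP <-].
    by apply: gnd; [exists (ilab P0)|exists (ilab P)|rewrite psiP0].
  apply: lb_le_inf; first by exists (g (psi (ilab P0))), P0.
  move=> _ [P /lower vP <-].
  by apply: gnd; [exists (ilab P0)|exists (ilab P)|rewrite psiP0].
apply/eqP; rewrite eq_le; apply/andP; split.
  apply: ub_le_sup; last by exists P0.
  exists (g (psi (ilab P0))) => _ [P /upper vP <-].
  by apply: gnd; [exists (ilab P)|exists (ilab P0)|rewrite psiP0].
apply: ge_sup; first by exists (g (psi (ilab P0))), P0.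
move=> _ [P /upper vP <-].
by apply: gnd; [exists (ilab P)|exists (ilab P0)|rewrite psiP0].
Qed.

End ObtainableIsDetermined.

Lemma continuous_is_payoff (R : realType) (A : finType) (phi : word A -> R) :
  continuous phi -> is_payoff phi.
Proof.
move=> phic; have nc : {within [set: word A], continuous (fun w => `|phi w|)}.
  apply: continuous_subspaceT => w.
  exact: (@cvg_norm R R^o (word A) (nbhs w) _ phi (phi w) (phic w)).
have [M MP] := compact_upper_bound (@compact_word A) nc.
by exists M => w; exact: MP.
Qed.

Lemma obtainable_determined (R : realType) (A : finType) (phi : word A -> R) :
  obtainable phi ->
  [/\ is_payoff phi, continuous phi & positionally_determined phi].
Proof.
move=> [K [d [f [g [[K0 Kc] dm fP [gc gnd] ->]]]]].
have fK a x : K x -> K (f a x) by have [+ _ _ _] := fP a; apply.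
have fcont a : {within K, continuous (f a)} by have [] := fP a.
have fnd a : nondecreasing_on K (f a) by have [] := fP a.
have fcontr a : contracting_on K d (f a) by have [] := fP a.
have psic := induced_payoff_continuous K0 Kc dm fK fcont fcontr.
have phic : continuous (g \o induced_payoff K f).
  apply/continuous_subspace_setT.
  by apply: (within_continuous_into _ gc) => [|w _];
    [exact: continuous_subspaceT|exists w].
split => //; first exact: continuous_is_payoff.
exact: induced_positionally_determined K0 Kc dm fK fcont fnd fcontr gnd.
Qed.

(** * Prefix-monotonicity *)

Section Prefixing.
Variables (R : realType) (A : finType).

(** The default argument of [nth] carries the tail: it is returned exactly when [i] is past the end
    of [u]. *)
Definition catw (u : seq A) (w : word A) : word A :=
  fun i => nth (w (i - size u)%N) u i.

Lemma catw_nil w : catw [::] w = w.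
Proof. by apply/funext => i; rewrite /catw nth_nil subn0. Qed.

Lemma catw_cat u v w : catw (u ++ v) w = catw u (catw v w).
Proof.
apply/funext => i; rewrite /catw nth_cat size_cat subnDA; case: ltnP => // iu.
  exact: set_nth_default.
by rewrite [RHS]nth_default.
Qed.

Lemma catw_agree n u w w' :
  agree n w w' -> agree (size u + n) (catw u w) (catw u w').
Proof.
move=> ww' i ilt; rewrite /catw; have [iu|iu] := ltnP i (size u).
  exact: set_nth_default.
by rewrite !nth_default// ww'// ltn_subLR.
Qed.

Lemma catw_prefix n w : catw (mkseq w n) (shift n w) = w.
Proof.
apply/funext => i; rewrite /catw size_mkseq /shift; have [iu|iu] := ltnP i n.
  by rewrite nth_mkseq.
by rewrite nth_default ?size_mkseq// subnKC.
Qed.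

(** Equivalent to totality of the preorder that compares two words after all prefixes at once. *)
Definition prefix_monotone (phi : word A -> R) := forall u v w w',
  phi (catw u w) < phi (catw u w') -> phi (catw v w) <= phi (catw v w').

End Prefixing.

(* From [branch_start b] every play first reads [u b] and arrives at the vertex
   [None], where Max chooses which of the two words [w false], [w true] is read next. A
   positional strategy has to make the same choice after both prefixes. *)
Section Branching.
Variables (R : realType) (A : finType) (L : nat) (u : bool -> seq A).
Variable w : bool -> word A.
Hypothesis u_size : forall b, (size (u b) <= L.+1)%N.
Hypothesis w_const : forall b i, (L < i)%N -> w b i = w b L.+1.

(* [Some (true, b, i)]: i+1 letters of [u b] remain to be read;
   [Some (false, b, i)]: i+1 letters of [w b] (or more, if i = L) have been read. *)
Let vtx : finType := option (bool * bool * 'I_L.+1).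

(** The choice [c] affects only the edge at [None]. The first counter runs down, hence [rev]. The
    second is capped at [L], where a loop repeats the letter [w b L.+1], in accordance with
    [w_const]. *)
Definition branch_next (c : bool) (s : vtx) : vtx * A * vtx :=
  match s with
  | None => (s, w c 0, Some (false, c, ord0))
  | Some (true, b, i) => (s, nth (w true 0) (rev (u b)) i,
      if i == 0 :> nat then None else Some (true, b, inord i.-1))
  | Some (false, b, i) => (s, w b i.+1, Some (false, b, inord (minn i.+1 L)))
  end.

Definition branch_edges : {set vtx * A * vtx} :=
  [set e | [exists c, e == branch_next c e.1.1]].

Lemma branch_next_source c s : (branch_next c s).1.1 = s.
Proof. by case: s => [[[[] b] i]|]. Qed.

Lemma branch_next_edge c s : branch_next c s \in branch_edges.
Proof. by rewrite inE; apply/existsP; exists c; rewrite branch_next_source. Qed.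

Lemma branch_has_move s : exists a t, (s, a, t) \in branch_edges.
Proof.
have := branch_next_edge true s; have := branch_next_source true s.
by case: (branch_next true s) => [[s' a] t] /= ->; exists a, t.
Qed.

Lemma branch_disjoint : [disjoint [set: vtx]%SET & finset.set0]%B.
Proof. by rewrite -setI_eq0 finset.setI0. Qed.

Definition branch_graph : game_graph A :=
  @GameGraph A vtx [set: vtx]%SET finset.set0 branch_edges (finset.setU0 _)
    branch_disjoint branch_has_move.

Lemma branch_next_unique c (e : vtx * A * vtx) :
  e \in branch_edges -> e.1.1 != None -> e = branch_next c e.1.1.
Proof.
rewrite inE => /existsP[c' /eqP e_next]; rewrite [X in _ -> X = _]e_next.
by case: (e.1.1) => [[[[] b] i]|].
Qed.

Definition branch_play c (s : vtx) : ipath branch_graph :=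
  @play A branch_graph (branch_next c) (branch_next_edge c) (branch_next_source c) s.

Let reach c s n : vtx := iter n (fun t => (branch_next c t).2) s.

Lemma ilab_branch_play c s n : ilab (branch_play c s) n = (branch_next c (reach c s n)).1.2.
Proof. by []. Qed.

Let remaining b n : vtx := if n is i.+1 then Some (true, b, inord i) else None.

Definition branch_start b : vtx := remaining b (size (u b)).

Lemma branch_next_remaining c b n : (n <= L)%N ->
  branch_next c (remaining b n.+1) =
  (remaining b n.+1, nth (w true 0) (rev (u b)) n, remaining b n).
Proof.
by move=> nL; rewrite /= inordK//; case: n nL.
Qed.

Lemma reach_remaining c b n k : (n + k <= L.+1)%N ->
  reach c (remaining b (n + k)) n = remaining b k.
Proof.
elim: n => // n IHn nk; rewrite /reach iterSr addSn branch_next_remaining//=.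
by apply: IHn; apply: ltnW.
Qed.

Lemma reach_read c n : reach c None n.+1 = Some (false, c, inord (minn n L)).
Proof.
elim: n => [|n IHn].
  by rewrite /reach /= min0n; congr (Some (_, _, _)); apply/val_inj; rewrite /= inordK.
rewrite /reach iterS -/(reach c None n.+1) IHn /=; congr (Some (_, _, _)).
rewrite inordK ?ltnS ?geq_minr//; congr inord; have [nL|nL] := leqP n L.
  by [].
by rewrite (minn_idPr (leqW (ltnW nL))) (minn_idPr (leqnSn L)).
Qed.

Lemma ilab_branch_start c b :
  ilab (branch_play c (branch_start b)) = catw (u b) (w c).
Proof.
apply/funext => n; rewrite ilab_branch_play /branch_start.
have [nu|un] := ltnP n (size (u b)).
  have un : size (u b) = (n + (size (u b) - n.+1).+1)%N.
    by rewrite addnS -addSn subnKC.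
  rewrite {1}un reach_remaining -?un// branch_next_remaining; last first.
    by have := u_size b; rewrite {1}un addnS ltnS; apply: leq_trans; rewrite leq_addl.
  rewrite /= nth_rev; last by rewrite ltn_subrL (leq_ltn_trans _ nu).
  by rewrite subnSK// subKn 1?ltnW// /catw; exact: set_nth_default.
rewrite /catw nth_default// -[n in LHS](subnK un) /reach iterD.
have := @reach_remaining c b (size (u b)) 0; rewrite addn0 /reach => ->//.
case: (n - size (u b))%N => [//|k].
rewrite -/(reach c None k.+1) reach_read /= inordK ?ltnS ?geq_minr//.
by have [//|kL] := leqP k L; rewrite [RHS]w_const// ltnS ltnW.
Qed.

(** Max owns every vertex, so the value of [tau] is the supremum over all plays. The equilibrium
    makes the play of [sigma] reach it from both starting vertices. *)
Lemma branching_choice (phi : word A -> R) :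
  is_payoff phi -> positionally_determined phi ->
  exists c, forall b c', phi (catw (u b) (w c')) <= phi (catw (u b) (w c)).
Proof.
move=> [M phiM] /(_ branch_graph)[sigma [tau [sigmap _ eq_val]]].
have inMax p : @ftarget A branch_graph p \in VMax branch_graph by rewrite inE.
(* The answer to the 0-length path at [None] reveals [c]; positionality repeats it after either
   prefix. *)
pose p0 := @FPath A branch_graph None [::] isT.
have s0 : source (move sigma (inMax p0)) = None := move_source sigma (inMax p0).
have /= := move_in sigma (inMax p0).
rewrite inE => /existsP[c /eqP mv0].
have {}mv0 : move sigma (inMax p0) = branch_next c None :=
  etrans mv0 (congr1 (branch_next c) s0).
exists c => b c'.
have cons : consistent sigma (branch_play c (branch_start b)).
  move=> n Un; set p := iprefix _ n in Un *.
  have es : source (move sigma Un) = ftarget p := move_source sigma Un.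
  have pn : ftarget p = source (branch_play c (branch_start b) n).
    exact: ftarget_iprefix.
  have -> : branch_play c (branch_start b) n = branch_next c (ftarget p).
    by rewrite pn /= /play_edge /source /= branch_next_source.
  have [pN|pN] := eqVneq (ftarget p) (None : vtx).
    by rewrite pN -mv0; apply: sigmap; rewrite pN.
  rewrite -es; apply: branch_next_unique; first exact: (move_in sigma Un).
  by apply: contraNneq pN => <-; rewrite -es.
have := eq_val (branch_start b); rewrite /ValMax /ValMin => eqv.
have le_c : inf [set phi (ilab P) | P in Defs.Cons (branch_start b : vertex branch_graph) sigma]
    <= phi (catw (u b) (w c)).
  apply: ge_inf.
    by exists (- M) => _ [P _ <-]; have := phiM (ilab P); rewrite ler_norml => /andP[].
  exists (branch_play c (branch_start b)); last by rewrite ilab_branch_start.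
  by split => //; exact: isource_play.
apply: le_trans le_c; rewrite eqv; apply: ub_le_sup.
  by exists M => _ [P _ <-]; have := phiM (ilab P); rewrite ler_norml => /andP[].
exists (branch_play c' (branch_start b)); last by rewrite ilab_branch_start.
split; first exact: isource_play.
(* Consistency with [tau] is vacuous: Min owns no vertex. *)
by move=> n Un; exfalso; move: (Un); rewrite inE.
Qed.

End Branching.

Lemma determined_prefix_monotone (R : realType) (A : finType) (phi : word A -> R) :
  is_payoff phi -> continuous phi -> positionally_determined phi ->
  prefix_monotone phi.
Proof.
move=> phip phic phid u v w w' uww'; rewrite leNgt; apply/negP => vww'.
(* Half the smaller gap: replacing both words of a comparison by their truncations moves the
   difference by less than [2 * e], so both strict inequalities survive. *)
pose e := Num.min (phi (catw u w') - phi (catw u w))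
  (phi (catw v w) - phi (catw v w')) / 2.
have e0 : 0 < e by rewrite divr_gt0// lt_min !subr_gt0 uww'.
have eu : e * 2 <= phi (catw u w') - phi (catw u w) by rewrite divfK// ge_min lexx.
have ev : e * 2 <= phi (catw v w) - phi (catw v w') by rewrite divfK// ge_min lexx orbT.
have [n nP] := word_unif_continuous phic e0.
(* Eventually constant words can be read in a finite graph. *)
pose stop (x : word A) : word A := fun i => x (minn i n).
have stopP x s : `|phi (catw s x) - phi (catw s (stop x))| < e.
  apply/nP/(agree_le (leq_addl (size s) n))/catw_agree => i ilt.
  by rewrite /stop (minn_idPl (ltnW ilt)).
pose L := maxn n (maxn (size u) (size v)).
have [||c cP] := @branching_choice R A L (fun b => if b then u else v)
  (fun b => if b then stop w' else stop w) _ _ phi phip phid.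
- by case; rewrite leqW// !leq_max leqnn !orbT.
- move=> b i Li; have nL : (n <= L)%N by rewrite leq_max leqnn.
  rewrite /stop; case: b; rewrite !(minn_idPr _)//; [exact: leqW| |exact: leqW|];
    exact: leq_trans nL (ltnW Li).
have := stopP w u; have := stopP w' u; have := stopP w v; have := stopP w' v.
(* Choosing [w'] is wrong after [v], and choosing [w] is wrong after [u]. *)
rewrite !ltr_distl; case: c cP => cP.
  by have := cP false false; rewrite /=; lra.
by have := cP true true; rewrite /=; lra.
Qed.

(** * Realization of prefix-monotone payoffs *)

Section DyadicSum.
Variable R : realType.
Implicit Types b c : nat -> R.

Definition dyadic_sum b := limn (series (fun n => b n * 2^-1 ^+ n)).

Lemma dyadic_weight_ge0 n : 0 <= 2^-1 ^+ n :> R.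
Proof. by rewrite exprn_ge0// invr_ge0. Qed.

Lemma cvg_dyadic_sum_const (e : R) :
  series (fun n => e * 2^-1 ^+ n) @ \oo --> e * 2.
Proof.
have -> : e * 2 = e * (1 - 2^-1)^-1 by rewrite [X in X - _]splitr div1r addrK invrK.
apply: (@cvg_geometric_series R e 2^-1).
by rewrite ger0_norm ?invr_ge0// invf_lt1// ltr1n.
Qed.

Lemma is_cvg_dyadic_sum b M : (forall n, `|b n| <= M) ->
  cvgn (series (fun n => b n * 2^-1 ^+ n)).
Proof.
move=> bM; apply: normed_cvg.
have M0 : 0 <= M := le_trans (normr_ge0 _) (bM 0%N).
apply: (series_le_cvg (v_ := fun n => M * 2^-1 ^+ n)) => [n|n|n|] /=.
- exact: normr_ge0.
- by rewrite mulr_ge0// dyadic_weight_ge0.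
- by rewrite normrM (ger0_norm (dyadic_weight_ge0 n)) ler_wpM2r// dyadic_weight_ge0.
- by apply/cvg_ex; exists (M * 2); exact: cvg_dyadic_sum_const.
Qed.

Lemma dyadic_sum_le b c M : (forall n, `|b n| <= M) -> (forall n, `|c n| <= M) ->
  (forall n, b n <= c n) -> dyadic_sum b <= dyadic_sum c.
Proof.
move=> bM cM bc; apply: lim_series_le; [exact: is_cvg_dyadic_sum bM|
  exact: is_cvg_dyadic_sum cM|move=> n].
by rewrite ler_wpM2r// dyadic_weight_ge0.
Qed.

Lemma dyadic_sumB b c M : (forall n, `|b n| <= M) -> (forall n, `|c n| <= M) ->
  dyadic_sum (fun n => b n - c n) = dyadic_sum b - dyadic_sum c.
Proof.
move=> bM cM; rewrite /dyadic_sum -lim_seriesB; [|exact: is_cvg_dyadic_sum bM|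
  exact: is_cvg_dyadic_sum cM].
by congr (limn (series _)); apply/funext => n; rewrite mulrBl.
Qed.

Lemma dyadic_sum_const (e : R) : dyadic_sum (fun=> e) = e * 2.
Proof. by apply: cvg_lim; [exact: Rhausdorff|exact: cvg_dyadic_sum_const]. Qed.

Lemma dyadic_sum_ge_term b M n : (forall k, 0 <= b k <= M) ->
  b n * 2^-1 ^+ n <= dyadic_sum b.
Proof.
move=> bM; have b0 k : 0 <= b k * 2^-1 ^+ k.
  by rewrite mulr_ge0 ?dyadic_weight_ge0//; case/andP: (bM k).
have bnM k : `|b k| <= M by case/andP: (bM k) => *; rewrite ger0_norm.
have := nondecreasing_cvgn_le _ (is_cvg_dyadic_sum bnM) n.+1.
move=> /(_ (nondecreasing_series (fun k _ _ => b0 k))); apply: le_trans.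
by rewrite /series/= big_nat_recr//= lerDr sumr_ge0.
Qed.

End DyadicSum.

(** * A pseudometric and an order embedding for words *)

Section PrefixDistance.
Variables (R : realType) (A : finType) (phi : word A -> R).
Hypothesis phic : continuous phi.

Definition prefix_weight (n : nat) : R := 2 - 2^-1 ^+ n.

Lemma prefix_weight_ge1 n : 1 <= prefix_weight n.
Proof.
have : 2^-1 ^+ n <= 1 :> R by rewrite exprn_ile1// ?invr_ge0// invf_le1// ler1n.
by rewrite /prefix_weight; lra.
Qed.

Lemma prefix_weight_le2 n : prefix_weight n <= 2.
Proof. by have := @dyadic_weight_ge0 R n; rewrite /prefix_weight; lra. Qed.

(** The weight grows by [2^-1 ^+ k.+1], which is at least [2^-1 ^+ n.+1], while no weight exceeds
    2. *)
Lemma prefix_weight_step n k : (k <= n)%N ->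
  prefix_weight k <= (1 - 2^-1 ^+ n.+2) * prefix_weight k.+1.
Proof.
move=> kn; have nk : 2^-1 ^+ n <= 2^-1 ^+ k :> R.
  by rewrite ler_wiXn2l// ?invr_ge0// invf_le1// ler1n.
have := @dyadic_weight_ge0 R n; have := @dyadic_weight_ge0 R k.
by rewrite /prefix_weight !exprS; nra.
Qed.

(** Only a pseudometric on words; for prefix-monotone [phi] it induces a metric on the values of
    [prefix_sum], which identify exactly the words at distance 0. *)
Definition prefix_dist (w w' : word A) : R :=
  sup [set prefix_weight (size u) * `|phi (catw u w) - phi (catw u w')| | u in setT].

Lemma prefix_dist_le w w' c :
  (forall u, prefix_weight (size u) * `|phi (catw u w) - phi (catw u w')| <= c) ->
  prefix_dist w w' <= c.
Proof.
move=> uc; apply: ge_sup; last by move=> _ [u _ <-].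
by exists (prefix_weight (size (Nil A)) * `|phi (catw [::] w) - phi (catw [::] w')|), [::].
Qed.

Lemma prefix_dist_ub w w' u :
  prefix_weight (size u) * `|phi (catw u w) - phi (catw u w')| <= prefix_dist w w'.
Proof.
apply: ub_le_sup; last by exists u.
have [M MP] := continuous_is_payoff phic.
exists (2 * (M + M)) => _ [v _ <-].
apply: ler_pM => //; [exact: le_trans (prefix_weight_ge1 _)|exact: prefix_weight_le2|].
by rewrite (le_trans (ler_normB _ _))// lerD.
Qed.

Lemma prefix_dist_ge w w' u :
  `|phi (catw u w) - phi (catw u w')| <= prefix_dist w w'.
Proof.
apply: le_trans (prefix_dist_ub w w' u); rewrite ler_peMl//; exact: prefix_weight_ge1.
Qed.

Lemma prefix_dist_ge0 w w' : 0 <= prefix_dist w w'.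
Proof. exact: le_trans (prefix_dist_ge w w' [::]). Qed.

Lemma prefix_dist_le2 w w' e :
  (forall u, `|phi (catw u w) - phi (catw u w')| <= e) -> prefix_dist w w' <= 2 * e.
Proof.
move=> ue; apply: prefix_dist_le => u.
apply: ler_pM => //; [exact: le_trans (prefix_weight_ge1 _)|exact: prefix_weight_le2].
Qed.

Lemma prefix_dist_eq0 w w' : prefix_dist w w' = 0 <->
  forall u, phi (catw u w) = phi (catw u w').
Proof.
split=> [d0 u|ww'].
  apply/eqP; rewrite -subr_eq0 -normr_le0 -d0; exact: prefix_dist_ge.
apply/eqP; rewrite eq_le prefix_dist_ge0 andbT -(mulr0 2).
by apply: prefix_dist_le2 => u; rewrite ww' subrr normr0.
Qed.

Lemma prefix_distC w w' : prefix_dist w w' = prefix_dist w' w.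
Proof.
by congr (sup _); apply/seteqP; split=> _ [u _ <-]; exists u => //; rewrite distrC.
Qed.

Lemma prefix_dist_triangle w1 w2 w3 :
  prefix_dist w1 w3 <= prefix_dist w1 w2 + prefix_dist w2 w3.
Proof.
apply: prefix_dist_le => u.
have := prefix_dist_ub w1 w2 u; have := prefix_dist_ub w2 w3 u.
have := ler_distD (phi (catw u w2)) (phi (catw u w1)) (phi (catw u w3)).
by have := prefix_weight_ge1 (size u); nra.
Qed.

Lemma prefix_dist_congr w1 w2 v1 v2 : prefix_dist w1 v1 = 0 -> prefix_dist w2 v2 = 0 ->
  prefix_dist w1 w2 = prefix_dist v1 v2.
Proof.
move=> /prefix_dist_eq0 e1 /prefix_dist_eq0 e2; congr (sup _).
by apply/seteqP; split=> _ [u _ <-]; exists u => //; rewrite e1 e2.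
Qed.

Lemma prefix_unif_continuous e : 0 < e -> exists n, forall w w', agree n w w' ->
  forall u, `|phi (catw u w) - phi (catw u w')| < e.
Proof.
move=> /(word_unif_continuous phic)[n nP]; exists n => w w' ww' u.
exact/nP/(agree_le (leq_addl (size u) n))/catw_agree.
Qed.

Lemma prefix_dist_small e : 0 < e ->
  exists n, forall w w', agree n w w' -> prefix_dist w w' < e.
Proof.
move=> e0; have [|n nP] := @prefix_unif_continuous (e / 3); first by rewrite divr_gt0.
exists n => w w' /nP wu; apply: (@le_lt_trans _ _ (2 * (e / 3))); last by lra.
by apply: prefix_dist_le2 => u; exact: ltW.
Qed.

(* Long prefixes contribute little by uniform continuity, and for the short ones
   the weight strictly increases when the letter [a] is added to the prefix. *)
Lemma prefix_dist_contracting a w w' : prefix_dist w w' != 0 ->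
  prefix_dist (catw [:: a] w) (catw [:: a] w') < prefix_dist w w'.
Proof.
move=> d_neq0; have d0 : 0 < prefix_dist w w' by rewrite lt_neqAle eq_sym d_neq0 prefix_dist_ge0.
have [|n nP] := word_unif_continuous phic (e := prefix_dist w w' / 4).
  by rewrite divr_gt0.
(* A factor below 1 common to all prefixes is required, since strict inequalities for each prefix
   would not survive the supremum. *)
apply: (@le_lt_trans _ _ ((1 - 2^-1 ^+ n.+2) * prefix_dist w w')); last first.
  have : 0 < 2^-1 ^+ n.+2 :> R by rewrite exprn_gt0// invr_gt0.
  by nra.
apply: prefix_dist_le => u; rewrite -!catw_cat.
have [un|nu] := leqP (size u) n.
  have := prefix_dist_ub w w' (u ++ [:: a]); rewrite size_cat addn1.
  have := prefix_weight_step un.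
  have : 2^-1 ^+ n.+2 <= 1 :> R by rewrite exprn_ile1// ?invr_ge0// invf_le1// ler1n.
  set x := `|_|; have : 0 <= x by exact: normr_ge0.
  set W := prefix_weight (size u); set W' := prefix_weight _; set q := 2^-1 ^+ n.+2.
  set D := prefix_dist w w'; move=> x0 q1 WW' W'D.
  apply: (@le_trans _ _ ((1 - q) * (W' * x))).
    by rewrite mulrA ler_wpM2r.
  by rewrite ler_wpM2l// subr_ge0.
have /ltW uxa : `|phi (catw (u ++ [:: a]) w) - phi (catw (u ++ [:: a]) w')|
    < prefix_dist w w' / 4.
  apply/nP/(agree_le _ (catw_agree (n := 0) _)) => //.
  by rewrite size_cat addn1 addn0 leqW// ltnW.
(* For long prefixes the weight is at most 2 and the difference at most a quarter of the distance;
   the resulting half is within the factor by this bound. *)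
have q2 : 2^-1 ^+ n.+2 <= 2^-1 :> R.
  by rewrite exprS ler_piMr ?invr_ge0// exprn_ile1// ?invr_ge0// invf_le1// ler1n.
have := prefix_weight_le2 (size u); have := prefix_weight_ge1 (size u).
move: uxa; set x := `|_|; have : 0 <= x by exact: normr_ge0.
by nra.
Qed.

Hypothesis phim : prefix_monotone phi.

Definition prefix_le (w w' : word A) := forall u, phi (catw u w) <= phi (catw u w').

Lemma prefix_le_total w w' : prefix_le w w' \/ prefix_le w' w.
Proof.
have [?|/existsNP[u /negP]] := pselect (prefix_le w w'); first by left.
by rewrite -ltNge => uw; right => v; exact: phim uw.
Qed.

Lemma prefix_le_catw w w' u : prefix_le w w' -> prefix_le (catw u w) (catw u w').
Proof. by move=> ww' v; rewrite -!catw_cat. Qed.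

Definition prefix_value (w : word A) (n : nat) : R :=
  if unpickle n is Some u then phi (catw u w) else 0.

(* An order embedding of words, preordered by [prefix_le], into the reals: every
   prefix [u] enters the sum with a positive weight. *)
Definition prefix_sum (w : word A) : R := dyadic_sum (prefix_value w).

Lemma prefix_value_bounded : exists M, forall w n, `|prefix_value w n| <= M.
Proof.
have [M MP] := continuous_is_payoff phic; exists `|M| => w n; rewrite /prefix_value.
by case: unpickle => [u|]; [exact: le_trans (ler_norm _)|rewrite normr0].
Qed.

Lemma prefix_value_le w w' n : prefix_le w w' -> prefix_value w n <= prefix_value w' n.
Proof. by rewrite /prefix_value; case: unpickle. Qed.

Lemma prefix_sum_le w w' : prefix_le w w' -> prefix_sum w <= prefix_sum w'.
Proof.
move=> ww'; have [M MP] := prefix_value_bounded.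
by apply: (dyadic_sum_le (M := M)) => // n; exact: prefix_value_le.
Qed.

Lemma prefix_sum_lt w w' u : prefix_le w w' ->
  phi (catw u w) < phi (catw u w') -> prefix_sum w < prefix_sum w'.
Proof.
move=> ww' uww'; have [M MP] := prefix_value_bounded.
rewrite -subr_gt0 -(dyadic_sumB (M := M))//.
apply: lt_le_trans (dyadic_sum_ge_term (M := M + M) (pickle u) _).
  by rewrite mulr_gt0 ?exprn_gt0 ?invr_gt0// /prefix_value pickleK subr_gt0.
move=> n; rewrite subr_ge0 prefix_value_le//=.
by rewrite (le_trans (ler_norm _))// (le_trans (ler_normB _ _))// lerD.
Qed.

(** Totality reduces the direct implication to strict monotonicity of the sum. *)
Lemma prefix_sum_leP w w' : prefix_sum w <= prefix_sum w' <-> prefix_le w w'.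
Proof.
split=> [sww'|]; last exact: prefix_sum_le.
have [//|w'w u] := prefix_le_total w w'.
by rewrite leNgt; apply/negP => /(prefix_sum_lt w'w); rewrite ltNge sww'.
Qed.

Lemma prefix_sum_eqP w w' : prefix_sum w = prefix_sum w' <-> prefix_dist w w' = 0.
Proof.
split=> [sww'|/prefix_dist_eq0 ww'].
  have ww' : prefix_le w w' by apply/prefix_sum_leP; rewrite sww'.
  have w'w : prefix_le w' w by apply/prefix_sum_leP; rewrite sww'.
  by apply/prefix_dist_eq0 => u; apply/eqP; rewrite eq_le ww' w'w.
by apply/eqP; rewrite eq_le; apply/andP; split; apply: prefix_sum_le => u; rewrite ww'.
Qed.

Lemma prefix_sum_eq_phi w w' : prefix_sum w = prefix_sum w' -> phi w = phi w'.
Proof. by move=> /prefix_sum_eqP/prefix_dist_eq0/(_ [::]); rewrite !catw_nil. Qed.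

Lemma prefix_sum_eq_catw u w w' :
  prefix_sum w = prefix_sum w' -> prefix_sum (catw u w) = prefix_sum (catw u w').
Proof.
move=> /prefix_sum_eqP/prefix_dist_eq0 ww'.
by apply/prefix_sum_eqP/prefix_dist_eq0 => v; rewrite -!catw_cat.
Qed.

Lemma prefix_sum_dist w w' : prefix_sum w - prefix_sum w' <= prefix_dist w w' * 2.
Proof.
have [M MP] := prefix_value_bounded.
rewrite -(dyadic_sumB (M := M))// -dyadic_sum_const.
apply: (dyadic_sum_le (M := M + M + prefix_dist w w')) => n.
- apply: le_trans (ler_normB _ _) _; apply: (@le_trans _ _ (M + M)).
    exact: lerD.
  by rewrite lerDl prefix_dist_ge0.
- rewrite ger0_norm ?prefix_dist_ge0// lerDr.
  by rewrite addr_ge0// (le_trans _ (MP w 0%N)).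
rewrite /prefix_value; case: unpickle => [u|]; last by rewrite subrr prefix_dist_ge0.
exact: le_trans (ler_norm _) (prefix_dist_ge _ _ _).
Qed.

Lemma prefix_sum_continuous : continuous prefix_sum.
Proof.
apply/word_continuousP => w e e0.
have [|n nP] := @prefix_dist_small (e / 2); first by rewrite divr_gt0.
exists n => w' /nP dw; have := prefix_sum_dist w w'; have := prefix_sum_dist w' w.
by rewrite prefix_distC ltr_norml => h1 h2; apply/andP; split; lra.
Qed.

End PrefixDistance.

(** * Transfer of the structure on words to a compact set of reals *)

Section Realization.
Variables (R : realType) (A : finType) (phi : word A -> R) (w0 : word A).
Hypotheses (phic : continuous phi) (phim : prefix_monotone phi).

Let psi := prefix_sum phi.
Let K := range psi.

(** An arbitrary section of [prefix_sum] on its range, with [w0] as default elsewhere. The maps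
    below depend only on the class of the word chosen. *)
Definition prefix_repr (x : R) : word A := xget w0 [set w | prefix_sum phi w = x].

Let psi_repr w : psi (prefix_repr (psi w)) = psi w.
Proof. by apply: (xgetI w0 (P := [set w' | psi w' = psi w]) (x := w)). Qed.

Definition realized_map (a : A) (x : R) : R := prefix_sum phi (catw [:: a] (prefix_repr x)).

Definition realized_dist (x y : R) : R := prefix_dist phi (prefix_repr x) (prefix_repr y).

Let dist := prefix_dist phi.

Let psi_continuous : continuous psi. Proof. exact: prefix_sum_continuous. Qed.

Let dist_continuous : continuous (fun p : word A * word A => dist p.1 p.2).
Proof.
move=> [w w']; apply/(@cvgrPdist_lt R R^o (word A * word A)%type (nbhs (w, w'))) => e e0.
have [|n nP] := prefix_dist_small phic (e := e / 2); first by rewrite divr_gt0.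
exists (agree n w, agree n w'); first by split; exact: cylinder_nbhs.
move=> [v v'] [/= /nP wv /nP wv'].
have h1 := prefix_dist_triangle phic w v w'; have h2 := prefix_dist_triangle phic v v' w'.
have h3 := prefix_dist_triangle phic v w v'; have h4 := prefix_dist_triangle phic w w' v'.
have := prefix_distC phi w v; have := prefix_distC phi w' v'.
by rewrite ltr_norml /dist => *; apply/andP; split; lra.
Qed.

Let realized_mapE a w : realized_map a (psi w) = psi (catw [:: a] w).
Proof. exact/prefix_sum_eq_catw/psi_repr. Qed.

Let realized_distE w w' : realized_dist (psi w) (psi w') = dist w w'.
Proof.
by apply: (prefix_dist_congr phic); apply/(prefix_sum_eqP phic phim)/psi_repr.
Qed.

Let phi_repr w : phi (prefix_repr (psi w)) = phi w.
Proof. exact/(prefix_sum_eq_phi phic phim)/psi_repr. Qed.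

Let K_compact : compact K.
Proof.
apply: continuous_compact; last exact: compact_word.
exact: continuous_subspaceT.
Qed.

Let catw_continuous a : continuous (fun w => psi (catw [:: a] w)).
Proof.
have /word_continuousP uc := psi_continuous; apply/word_continuousP => w e e0.
have [n nP] := uc (catw [:: a] w) e e0; exists n => w' ww'.
apply/nP/(agree_le (leq_addl 1 n)); exact: (@catw_agree A n [:: a]).
Qed.

Let realized_metric : continuous_metric_on K realized_dist.
Proof.
split; first split.
- by move=> _ _ [w _ <-] [w' _ <-]; rewrite realized_distE prefix_dist_ge0.
- move=> _ _ [w _ <-] [w' _ <-]; rewrite realized_distE.
  by rewrite (prefix_sum_eqP phic phim).
- by move=> _ _ [w _ <-] [w' _ <-]; rewrite !realized_distE; exact: prefix_distC.
- move=> _ _ _ [w1 _ <-] [w2 _ <-] [w3 _ <-]; rewrite !realized_distE.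
  exact: prefix_dist_triangle.
(* As the image of a compact space of pairs of words, the square inherits continuity of the metric
   from [dist] by [continuous_factor]. *)
have -> : K `*` K = range (fun p : word A * word A => (psi p.1, psi p.2)).
  apply/seteqP; split=> [[x y] [/= [w _ <-] [w' _ <-]]|_ [[w w'] _ <-]].
    by exists (w, w').
  by split; [exists w|exists w'].
apply: continuous_factor.
- by rewrite -setXTT; apply: compact_setX; exact: compact_word.
- exact: norm_hausdorff.
- exact: continuous_square.
rewrite (_ : _ \o _ = fun p : word A * word A => dist p.1 p.2)//.
by apply/funext => p /=; rewrite realized_distE.
Qed.

Let realized_map_in a x : K x -> K (realized_map a x).
Proof. by move=> [w _ <-]; rewrite realized_mapE; exists (catw [:: a] w). Qed.

Let realized_map_continuous a : {within K, continuous (realized_map a)}.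
Proof.
apply: continuous_factor => //; first exact: compact_word.
rewrite (_ : _ \o _ = fun w => psi (catw [:: a] w))//.
by apply/funext => w /=; rewrite realized_mapE.
Qed.

Let realized_map_nondecreasing a : nondecreasing_on K (realized_map a).
Proof.
move=> _ _ [w _ <-] [w' _ <-]; rewrite !realized_mapE => /(prefix_sum_leP phic phim) ww'.
by apply/(prefix_sum_leP phic phim); exact: prefix_le_catw.
Qed.

Let realized_map_contracting a : contracting_on K realized_dist (realized_map a).
Proof.
move=> _ _ [w _ <-] [w' _ <-]; rewrite !realized_mapE !realized_distE => ww'.
apply: prefix_dist_contracting => //; apply/eqP => d0.
by apply: ww'; apply/(prefix_sum_eqP phic phim).
Qed.

Let comp_word_realized w n w' :
  comp_word realized_map w n (psi w') = psi (catw (mkseq w n) w').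
Proof.
elim: n w' => [|n IHn] w'; first by rewrite catw_nil.
by rewrite [LHS]/= realized_mapE IHn -catw_cat mkseqS cats1.
Qed.

(** Cutting [w] after [n] letters writes [psi w] as the composition along those letters applied to a
    point of [K], and such points approximate the induced payoff. *)
Let induced_payoff_realized : induced_payoff K realized_map = psi.
Proof.
apply/funext => w; apply/eqP; rewrite -subr_eq0 -normr_le0.
apply/ler_addgt0Pr => e e0; rewrite add0r.
have K0 : K !=set0 by exists (psi w0), w0.
have [n nP] := induced_payoff_approx K0 K_compact realized_metric realized_map_in
  realized_map_continuous realized_map_contracting e0.
have := nP w (psi (shift n w)); rewrite comp_word_realized catw_prefix => nw.
by apply/ltW/nw; exists (shift n w).
Qed.

Lemma prefix_monotone_obtainable : obtainable phi.
Proof.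
exists K, realized_dist, realized_map, (phi \o prefix_repr).
rewrite induced_payoff_realized; split => //.
- by split => //; exists (psi w0), w0.
- by move=> a; split => // x; exact: realized_map_in.
- split.
    apply: continuous_factor => //; first exact: compact_word.
    by rewrite (_ : _ \o _ = phi)//; apply/funext => w /=.
  move=> _ _ [w _ <-] [w' _ <-] /(prefix_sum_leP phic phim)/(_ [::]).
  by rewrite /= !phi_repr !catw_nil.
- by apply/funext => w /=.
Qed.

End Realization.

Theorem theorem6p3 (R : realType) (m : nat) (hm : (1 <= m)%N) :
  [set phi : word 'I_m -> R |
    [/\ is_payoff phi, continuous phi & positionally_determined phi]] =
  [set phi : word 'I_m -> R | obtainable phi].
Proof.
apply/seteqP; split=> [phi [phip phic phid]|phi]; last exact: obtainable_determined.
(* The bound [1 <= m] supplies a letter, hence the word that makes [K] nonempty. *)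
apply: (prefix_monotone_obtainable (fun=> Ordinal hm) phic).
exact: determined_prefix_monotone.
Qed.
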